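(* Let $n\ge1$ be an integer, $\beta$ a complex number, and $T_n^\beta=\tilde F_nE^{n\beta}\tilde F_n^{-1}$ acting on the space $\mathcal P_{n-1}$ of complex polynomials of degree at most $n-1$. Then for every $p=0,1,\dots,n-1$, $$T_n^\beta x^p=\sum_{m=p}^{n-1}\binom{n-1-p}{n-1-m}\binom{n+1+m}{m}^{-1}(1-x)^{n-m-1}\,t_m\big(-n\beta+n+m+1\,\big|\,n\beta,x\big),$$ where $t_k(\varphi|\gamma,x)=\sum_{j=0}^{k}\binom{\varphi}{j}\binom{\gamma}{k-j}x^j$.
   Context: $\tilde F_n$ is the linear operator on $\mathcal P_{n-1}$ with $\tilde F_n x^p=(1-x)^{2n+1}\sum_{m\ge1}m^{p+1}\binom{m+n}{n}x^{m-1}$, $p=0,\dots,n-1$ (a polynomial of degree $\le n-1$); it is invertible with $\tilde F_n^{-1}x^p=\frac{n!}{(2n)!}(x-1)_p[x+n+1]_{n-p-1}$, where $(\varphi)_k=\varphi(\varphi-1)\cdots(\varphi-k+1)$, $[\varphi]_k=\varphi(\varphi+1)\cdots(\varphi+k-1)$. $E^{c}$ is the shift $f(x)\mapsto f(x+c)$. $\binom{c}{k}=c(c-1)\cdots(c-k+1)/k!$ for complex $c$. *)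

(* Defs.v *)
(* The complex numbers are R[i] over an arbitrary R : realType. *)
From HB Require Import structures.
From mathcomp Require Import all_boot all_order all_algebra.
From mathcomp Require Import reals complex.

Set Implicit Arguments.
Unset Strict Implicit.
Unset Printing Implicit Defensive.
Import Order.TTheory GRing.Theory Num.Theory.
Local Open Scope ring_scope.

Definition gbinom (K : numFieldType) (c : K) (k : nat) : K :=
  (\prod_(i < k) (c - i%:R)) / (k`!)%:R.

Definition tpoly (K : numFieldType) (k : nat) (phi gamma : K) : {poly K} :=
  \sum_(j < k.+1) (gbinom phi j * gbinom gamma (k - j)) *: 'X^j.

(* A formal power series is its sequence of coefficients; this is the Cauchy
   product of a polynomial and a series. *)
Definition mulps (K : numFieldType) (q : {poly K}) (s : nat -> K) : nat -> K :=
  fun k => \sum_(j < k.+1) q`_j * s (k - j)%N.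

(* sum_(m >= 1) m^(p+1) C(m+n, n) x^(m-1): the coefficient of x^j is the term
   m = j+1. *)
Definition tF_sum (K : numFieldType) (n p : nat) : nat -> K :=
  fun j => j.+1%:R ^+ p.+1 * 'C(j.+1 + n, n)%:R.

Definition tF_series (K : numFieldType) (n p : nat) : nat -> K :=
  mulps ((1 - 'X) ^+ (2 * n).+1) (tF_sum K n p).

(* The space of polynomials of degree at most n-1 is {poly_n K}. Only the first
   n coefficients of tF_series are kept; by tF_series_eq0 below the others
   vanish, so nothing is lost (see tF_coef). *)
Definition tF_fun (K : numFieldType) (n : nat) (f : {poly_n K}) : {poly_n K} :=
  \sum_(p < n) f`_p *: mk_npoly n (tF_series K n p).

Definition tF (K : numFieldType) (n : nat) : 'End({poly_n K}) :=
  linfun (@tF_fun K n).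

Definition shift_fun (K : numFieldType) (n : nat) (c : K) (f : {poly_n K}) :
  {poly_n K} := npolyp n (f \Po ('X + c%:P)).

Definition shift (K : numFieldType) (n : nat) (c : K) : 'End({poly_n K}) :=
  linfun (@shift_fun K n c).

Definition Tbeta (K : numFieldType) (n : nat) (beta : K) : 'End({poly_n K}) :=
  (tF K n \o shift n (n%:R * beta) \o (tF K n)^-1)%VF.

Lemma tF_fun_linear (K : numFieldType) (n : nat) : linear (@tF_fun K n).
Proof.
move=> a u v; rewrite /tF_fun scaler_sumr -big_split /=.
apply: eq_bigr => p _.
by rewrite coefD coefZ scalerDl scalerA.
Qed.

HB.instance Definition _ (K : numFieldType) (n : nat) :=
  GRing.isLinear.Build K {poly_n K} {poly_n K} *:%R (@tF_fun K n)
    (@tF_fun_linear K n).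

Lemma shift_fun_linear (K : numFieldType) (n : nat) (c : K) :
  linear (@shift_fun K n c).
Proof.
move=> a u v; apply/npolyP => i.
rewrite /shift_fun /= coefD coefZ !coef_npolyp comp_polyD comp_polyZ coefD coefZ.
by case: ifP => // _; rewrite mulr0 addr0.
Qed.

HB.instance Definition _ (K : numFieldType) (n : nat) (c : K) :=
  GRing.isLinear.Build K {poly_n K} {poly_n K} *:%R (@shift_fun K n c)
    (@shift_fun_linear K n c).

Lemma shiftE (K : numFieldType) (n : nat) (c : K) (f : {poly_n K}) :
  shift n c f = f \Po ('X + c%:P) :> {poly K}.
Proof.
rewrite lfunE /= npolypK // size_comp_poly2 ?size_npoly //.
by rewrite size_XaddC.
Qed.

Lemma sum_binom_poly (K : numFieldType) (N : nat) (q : {poly K}) (a : K) :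
  (size q <= N)%N ->
  \sum_(j < N.+1) (-1) ^+ j * 'C(N, j)%:R * q.[a - j%:R] = 0.
Proof.
elim: N q a => [|N IHN] q a sq.
  by rewrite big1 // => j _; move: sq; rewrite size_poly_leq0 => /eqP ->;
    rewrite horner0 mulr0.
pose r := q - (q \Po ('X - 1%:P)).
have sr : (size r <= N)%N.
  have sc : size (q \Po ('X - 1%:P)) = size q.
    by rewrite size_comp_poly2 // size_XsubC.
  apply/leq_sizeP => i leNi; rewrite coefB.
  have [lt|ge] := ltnP i (size q); last first.
    by rewrite !nth_default ?sc // subrr.
  have ei : i = (size q).-1.
    move: lt sq; case: (size q) => // s les sN.
    by apply/eqP; rewrite eqn_leq -ltnS les (leq_trans _ leNi).
  have := @lead_coef_comp _ q ('X - 1%:P); rewrite size_XsubC => /(_ isT).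
  rewrite lead_coefXsubC expr1n mulr1 !lead_coefE sc -ei => ->.
  by rewrite subrr.
rewrite -[RHS](IHN r a sr) big_ord_recl bin0 expr0 !mul1r subr0.
under eq_bigr => i _ do rewrite lift0 binS natrD mulrDr mulrDl.
rewrite big_split /= [X in _ + (X + _)]big_ord_recr /= bin_small // mulr0 mul0r.
rewrite addr0.
under [RHS]eq_bigr => i _ do rewrite hornerD hornerN horner_comp mulrBr.
rewrite [RHS]big_split addrA; congr (_ + _).
  rewrite [RHS]big_ord_recl bin0 expr0 !mul1r subr0; congr (_ + _).
apply: eq_bigr => i _.
by rewrite exprS mulN1r !mulNr hornerXsubC -addrA -opprD natr1.
Qed.

Lemma binom_prod (K : numFieldType) (m n : nat) :
  'C(m + n, n)%:R * (n`!)%:R = \prod_(i < n) (m%:R + i.+1%:R) :> K.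
Proof.
rewrite -natrM bin_ffact; elim: n m => [|n IHn] m.
  by rewrite ffactn0 big_ord0.
by rewrite addnS ffactSS natrM IHn big_ord_recr /= mulrC -natrD addnS.
Qed.

Lemma tF_series_eq0 (K : numFieldType) (n p k : nat) :
  (p < n)%N -> (n <= k)%N -> tF_series K n p k = 0.
Proof.
move=> ltpn lenk; pose N := (2 * n).+1.
pose q : {poly K} := 'X ^+ p.+1 * \prod_(i < n) ('X + (i.+1%:R)%:P).
have sq : (size q <= N)%N.
  have -> : q = 'X ^+ p.+1 * \prod_(i < n) ('X - (- i.+1%:R)%:P).
    by congr (_ * _); apply: eq_bigr => i _; rewrite polyCN opprK.
  apply: leq_trans (size_polyMleq _ _) _.
  rewrite size_polyXn size_prod_XsubC /index_enum -enumT size_enum_ord.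
  by rewrite addnS /= addSn ltnS /N mul2n -addnn ltn_add2r.
have qE m : q.[m%:R] = m%:R ^+ p.+1 * 'C(m + n, n)%:R * (n`!)%:R.
  rewrite -mulrA binom_prod hornerM hornerXn horner_prod; congr (_ * _).
  by apply: eq_bigr => i _; rewrite !hornerE.
have q0 m : (m <= n)%N -> q.[- m%:R] = 0.
  case: m => [|m] le_mn; rewrite hornerM hornerXn.
    by rewrite oppr0 exprS !mul0r.
  by rewrite horner_prod (bigD1 (Ordinal le_mn)) //= hornerD hornerX hornerC addNr mul0r mulr0.
have fn0 : (n`!)%:R != 0 :> K by rewrite pnatr_eq0 -lt0n fact_gt0.
apply: (mulIf fn0); rewrite mul0r.
pose g j : K := (-1) ^+ j * 'C(N, j)%:R * q.[k.+1%:R - j%:R].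
have coefN j : ((1 - 'X) ^+ N : {poly K})`_j = (-1) ^+ j * 'C(N, j)%:R.
  rewrite exprBn coef_sum.
  have polyC_sign i : (-1) ^+ i = ((-1) ^+ i)%:P :> {poly K}.
    by rewrite polyC_exp polyCN.
  under eq_bigr => i _ do
    rewrite expr1n mulr1 coefMn polyC_sign mul_polyC coefZ coefXn.
  have [ltjN|geNj] := ltnP j N.+1.
    rewrite (bigD1 (Ordinal ltjN)) //= eqxx mulr1 mulr_natr big1 ?addr0 // => i.
    by rewrite -val_eqE /= eq_sym => /negPf ->; rewrite mulr0 mul0rn.
  rewrite bin_small // mulr0 big1 // => i _.
  by rewrite gtn_eqF ?mulr0 ?mul0rn // (leq_trans (ltn_ord i)).
have -> : tF_series K n p k * (n`!)%:R = \sum_(j < k.+1) g j.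
  rewrite /tF_series /mulps mulr_suml; apply: eq_bigr => j _.
  rewrite coefN /g -!mulrA; congr (_ * (_ * _)).
  have lejk : (j <= k)%N by rewrite -ltnS.
  by rewrite -natrB ?(leqW lejk) // subSn // qE /tF_sum -mulrA.
have gN j : (N < j)%N -> g j = 0.
  by move=> ltNj; rewrite /g bin_small // mulr0 mul0r.
have gk j : (k < j)%N -> g j = 0.
  move=> ltkj; have [/gN //|lejN] := ltnP N j.
  rewrite /g -opprB -natrB // q0 ?mulr0 // leq_subLR.
  apply: leq_trans lejN _; rewrite /N mul2n -addnn -addSn.
  by rewrite leq_add2r.
have widen a b : (forall j, (a <= j)%N -> g j = 0) ->
    \sum_(j < a) g j = \sum_(j < a + b) g j.
  move=> g0; rewrite big_split_ord /= [X in _ + X]big1 ?addr0 // => j _.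
  by rewrite g0 // leq_addr.
rewrite (widen k.+1 N.+1 gk) addnC -(widen N.+1 k.+1 gN).
exact: sum_binom_poly.
Qed.

Lemma tF_coef (K : numFieldType) (n : nat) (p : 'I_n) (k : nat) :
  (tF K n (tnth (npolyX K n) p))`_k = tF_series K n p k.
Proof.
rewrite lfunE /= /tF_fun (bigD1 p) //= big1 => [|i neip]; last first.
  by rewrite npolyXE coefXn [_ == _](negPf neip) scale0r.
rewrite npolyXE coefXn eqxx scale1r addr0 coef_poly.
by case: ltnP => // lenk; rewrite tF_series_eq0.
Qed.

(* Hence tF is invertible and the inverse in Tbeta is its two-sided inverse
   (lker0_compVf, lker0_compfV). *)
Lemma tF_lker0 (K : numFieldType) (n : nat) : lker (tF K n) == 0%VS.
Proof.
apply/eqP/vspaceP => f; rewrite memv0 memv_ker.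
apply/eqP/eqP => [Ff0|->]; last by rewrite linear0.
pose s j := j.+1%:R * f.[j.+1%:R] * 'C(j.+1 + n, n)%:R.
have sE j : s j = \sum_(p < n) f`_p * tF_sum K n p j.
  rewrite /s (horner_coef_wide _ (size_npoly f)) mulr_sumr mulr_suml.
  apply: eq_bigr => p _; rewrite /tF_sum exprS !mulrA; congr (_ * _ * _).
  by rewrite mulrC.
have s0 k : mulps ((1 - 'X) ^+ (2 * n).+1) s k = 0.
  transitivity ((tF K n f)`_k); last by rewrite Ff0 coef0.
  have -> : mulps ((1 - 'X) ^+ (2 * n).+1) s k =
      \sum_(p < n) f`_p * tF_series K n p k.
    rewrite /tF_series /mulps; under eq_bigr => j _ do rewrite sE mulr_sumr.
    rewrite exchange_big /=; apply: eq_bigr => p _.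
    by rewrite mulr_sumr; apply: eq_bigr => j _; rewrite mulrCA.
  rewrite lfunE /= /tF_fun coefn_sum; apply: eq_bigr => p _.
  rewrite coefZ coef_poly; congr (_ * _).
  by case: ltnP => // lenk; rewrite tF_series_eq0.
have s_eq0 k : s k = 0.
  elim/ltn_ind: k => k IHk; have := s0 k.
  rewrite /mulps big_ord_recl subn0 big1 ?addr0 => [|j _]; last first.
    by rewrite lift0 IHk ?mulr0 // ltn_subrL /= (leq_ltn_trans _ (ltn_ord j)).
  by rewrite -horner_coef0 horner_exp hornerD hornerN hornerX hornerC subr0
    expr1n mul1r.
have froot j : root f j.+1%:R.
  have /eqP := s_eq0 j; rewrite /s !mulf_eq0 !pnatr_eq0 /= => /orP[//|].
  by rewrite -leqn0 leqNgt bin_gt0 leq_addl.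
apply/val_inj/eqP/negPn/negP => /= fn0.
have := max_poly_roots (rs := [seq j.+1%:R | j <- iota 0 n]) fn0.
rewrite size_map size_iota ltnNge size_npoly => H.
suff: false by []. apply: H.
  by apply/allP => _ /mapP[j _ ->].
by rewrite map_inj_uniq ?iota_uniq // => i j /eqP; rewrite eqr_nat => /eqP[].
Qed.

(* Main.v *)
(* At x = i + 1 a polynomial f contributes (i + 1) f(i + 1) C(i + 1 + n, n) to
   the i-th coefficient of the series defining tF f.  For
     f = n!/(n+m+1)! (x-1)_j [x+n+1]_(m-j)
   that coefficient is C(i-j+n+m+1, n+m+1), so tF f = x^j (1-x)^(n-1-m); the case
   m = n - 1 inverts tF.  Put c = n beta.  The Vandermonde identity expands the
   shifted preimage of x^p in the (x+c-1)_m, p <= m < n, and the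
   Pfaff-Saalschutz identity expands each (x+c-1)_m in the (x-1)_j [x+n+1]_(m-j),
   the coefficients being those of t_m(-c+n+m+1 | c, x). *)
Require Import Defs.
From mathcomp Require Import all_boot all_order all_algebra.
From mathcomp Require Import reals complex.
From mathcomp Require Import ring zify.
Set Implicit Arguments.
Unset Strict Implicit.
Unset Printing Implicit Defensive.
Import Order.TTheory GRing.Theory Num.Theory.
Local Open Scope ring_scope.

(** * Factorial identities: Vandermonde and Pfaff-Saalschutz *)

Definition falling (K : comNzRingType) (a : K) (k : nat) : K :=
  \prod_(i < k) (a - i%:R).

Definition rising (K : comNzRingType) (a : K) (k : nat) : K :=
  \prod_(i < k) (a + i%:R).

Section Factorials.
Variable K : comNzRingType.
Implicit Types a b c s z : K.

Lemma falling0 a : falling a 0 = 1.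
Proof. exact: big_ord0. Qed.

Lemma fallingSr a k : falling a k.+1 = falling a k * (a - k%:R).
Proof. exact: big_ord_recr. Qed.

Lemma fallingS a k : falling a k.+1 = a * falling (a - 1) k.
Proof.
rewrite /falling big_ord_recl subr0; congr (_ * _).
by apply: eq_bigr => i _; rewrite lift0; ring.
Qed.

Lemma rising0 a : rising a 0 = 1.
Proof. exact: big_ord0. Qed.

Lemma risingSr a k : rising a k.+1 = rising a k * (a + k%:R).
Proof. exact: big_ord_recr. Qed.

Lemma falling_nat n k : falling (n%:R : K) k = (n ^_ k)%:R.
Proof.
elim: k => [|k IHk]; first by rewrite falling0 ffactn0.
rewrite fallingSr IHk ffactnSr natrM.
have [lekn|ltnk] := leqP k n; first by rewrite natrB.
by rewrite ffact_small // !mul0r.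
Qed.

Lemma risingE a k : rising a k = falling (a + k%:R - 1) k.
Proof.
rewrite /falling (reindex_inj rev_ord_inj) /=; apply: eq_bigr => i _.
by rewrite natrB //; ring.
Qed.

Lemma fallingD a m k : falling a (m + k) = falling a m * falling (a - m%:R) k.
Proof.
elim: k => [|k IHk]; first by rewrite addn0 falling0 mulr1.
by rewrite addnS !fallingSr IHk; ring.
Qed.

(** Induction on [r]: in term [i] the new factor a+b-r splits as (a-i) + (b-(r-i)), and Pascal's
    rule recombines the two sums. *)
Lemma falling_Vandermonde a b r :
  falling (a + b) r =
  \sum_(i < r.+1) 'C(r, i)%:R * falling a i * falling b (r - i).
Proof.
elim: r => [|r IHr]; first by rewrite big_ord1 !falling0 !mulr1.
rewrite fallingSr IHr mulr_suml [RHS]big_ord_recl /= bin0 subn0.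
under [X in _ = _ + X]eq_bigr => i _ do
  rewrite /bump add1n binS natrD !mulrDl subSS.
rewrite big_split /= [X in _ = _ + (X + _)]big_ord_recr /= bin_small //.
rewrite !mul0r addr0 addrA.
have -> : 1 * falling a 0 * falling b r.+1 +
    \sum_(i < r) 'C(r, i.+1)%:R * falling a i.+1 * falling b (r - i) =
    \sum_(i < r.+1) 'C(r, i)%:R * falling a i * falling b (r.+1 - i).
  by rewrite [RHS]big_ord_recl /= bin0.
rewrite -big_split /=; apply: eq_bigr => i _.
have leir : (i <= r)%N by rewrite -ltnS.
by rewrite subSn // !fallingSr natrB //; ring.
Qed.

(* The right-hand side is the WZ certificate of the recurrence in m satisfied
   by the Pfaff-Saalschutz sum, found with denominators cleared. *)
Lemma saalschutz_telescope c s z m k : (k <= m.+1)%N ->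
  \sum_(j < k)
    ('C(m.+1, j)%:R * falling (s + m%:R - c) j * falling c (m.+1 - j)
       * falling z j * rising (z + s) (m.+1 - j)
     - (z + c - m%:R) * (s + m%:R)
       * ('C(m, j)%:R * falling (s + m%:R - 1 - c) j * falling c (m - j)
          * falling z j * rising (z + s) (m - j)))
  = if k is k'.+1 then
      'C(m, k')%:R * falling (s + m%:R - 1 - c) k' * falling c (m - k')
      * falling z k * rising (z + s) (m - k') * (c - s - (m + m - k')%:R)
    else 0.
Proof.
elim: k => [|k IHk] lekm; first by rewrite big_ord0.
rewrite big_ord_recr {}IHk 1?ltnW //=.
case: k lekm => [|k]; rewrite ltnS => lekm.
  rewrite !bin0 !subn0 !fallingSr !falling0 risingSr natrD.
  by ring.
have e : (m - k)%N = (m - k.+1).+1 by rewrite subnS prednK // subn_gt0.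
have eB : (k.+1%:R * 'C(m, k.+1)%:R : K) = (m%:R - k%:R) * 'C(m, k)%:R.
  by rewrite -natrB 1?ltnW // -!natrM mul_bin_left.
rewrite subSS e binS.
have -> : s + m%:R - c = (s + m%:R - 1 - c) + 1 by ring.
rewrite [falling (_ + 1) _]fallingS addrK !fallingSr !risingSr.
rewrite !natrB ?natrD ?(leq_trans lekm) ?leq_addr //; last first.
  by rewrite (leq_trans (ltnW lekm)) ?leq_addr.
set A := falling (s + _ - _ - _) k; set C := falling c _; set Z := falling z k.
set W := rising _ _.
set B := 'C(m, k)%:R in eB *; set B' := 'C(m, k.+1)%:R in eB *.
apply/eqP; rewrite -subr_eq0; apply/eqP.
(* The difference of the two sides is a multiple of the difference of the two sides of [eB]. *)
transitivity (A * C * Z * W * (z - k%:R) * (c - (m%:R - k.+1%:R))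
  * (z + s + (m%:R - k.+1%:R)) * (k.+1%:R * B' - (m%:R - k%:R) * B)).
  by ring.
by rewrite eB subrr mulr0.
Qed.

(** Passing from m to m+1 multiplies both sides by (z+c-m)(s+m); for the sum this comes from
    telescoping over j <= m. *)
Lemma saalschutz c s z m :
  \sum_(j < m.+1)
    'C(m, j)%:R * falling (s + m%:R - 1 - c) j * falling c (m - j)
      * falling z j * rising (z + s) (m - j)
  = falling (z + c) m * rising s m.
Proof.
elim: m => [|m IHm]; first by rewrite big_ord1 !falling0 !rising0 !mulr1.
rewrite fallingSr risingSr.
transitivity ((z + c - m%:R) * (s + m%:R) * (falling (z + c) m * rising s m));
  last by ring.
rewrite -IHm; have := saalschutz_telescope c s z (leqnn m.+1).
rewrite sumrB -mulr_sumr => /(canRL (subrK _)) e.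
rewrite big_ord_recr /=.
under eq_bigr => j _ do rewrite -natr1 addrA addrK.
rewrite e addrAC addrC.
rewrite -[RHS]addr0; congr (_ + _).
(* The term j = m+1, outside the telescoped range, cancels the certificate at k = m+1. *)
rewrite !subnn !binn addnK !falling0 !rising0 [falling (_ - c) m.+1]fallingS.
have -> : s + m.+1%:R - 1 - c - 1 = s + m%:R - 1 - c by ring.
by ring.
Qed.

End Factorials.

(** * Power series multiplied by powers of 1-x *)

Section Series.
Variable K : numFieldType.
Implicit Types (q r : {poly K}) (s : nat -> K).

(** Truncating the series makes the ring laws of polynomials available. *)
Lemma mulps_trunc q s L k : (k < L)%N ->
  mulps q s k = (q * \poly_(i < L) s i)`_k.
Proof.
move=> ltkL; rewrite coefM; apply: eq_bigr => j _.
by rewrite coef_poly (leq_ltn_trans (leq_subr _ _) ltkL).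
Qed.

Lemma mulpsM q r s k : mulps (q * r) s k = mulps q (mulps r s) k.
Proof.
rewrite (mulps_trunc _ _ (ltnSn k)) -mulrA coefM; apply: eq_bigr => j _.
by rewrite (mulps_trunc _ _ (_ : (k - j < k.+1)%N)) // ltnS leq_subr.
Qed.

Lemma eq_mulps q s s' k : s =1 s' -> mulps q s k = mulps q s' k.
Proof. by move=> es; apply: eq_bigr => j _; rewrite es. Qed.

Lemma mulps_suml I (r : seq I) (q : {poly K}) (a : I -> K) (s : I -> nat -> K) k :
  mulps q (fun i => \sum_(l <- r) a l * s l i) k =
  \sum_(l <- r) a l * mulps q (s l) k.
Proof.
rewrite /mulps; under eq_bigr do rewrite mulr_sumr.
rewrite exchange_big /=; apply: eq_bigr => l _.
by rewrite mulr_sumr; apply: eq_bigr => j _; rewrite mulrCA.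
Qed.

(** The expansion of x^j / (1-x)^(N+1). The test is needed because i-j is truncated to 0 for i <
    j. *)
Definition binom_series (N j : nat) (i : nat) : K :=
  if (j <= i)%N then 'C(i - j + N, N)%:R else 0.

Lemma mulps_binom_series N j k :
  mulps ((1 - 'X) ^+ N.+1) (binom_series N j) k = (k == j)%:R.
Proof.
have mulps1BX s i :
    mulps (1 - 'X) s i = s i - (if i is i'.+1 then s i' else 0).
  rewrite (mulps_trunc _ _ (ltnSn i)) mulrBl mul1r coefB coefXM !coef_poly ltnSn.
  by case: i => [|i] //=; rewrite ltnW.
elim: N k => [|N IHN] k.
  rewrite expr1 mulps1BX /binom_series.
  case: k => [|k]; first by rewrite leqn0 eq_sym bin0 subr0; case: eqP.
  rewrite !bin0 (leq_eqVlt j) ltnS (eq_sym k.+1).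
  by case: (eqVneq j k.+1) => [->|_] /=; rewrite ?ltnn ?subr0 ?subrr.
(* One factor 1-x lowers N+1 to N, by Pascal's rule. *)
rewrite exprSr mulpsM -[RHS]IHN; apply: eq_mulps => i; rewrite mulps1BX.
rewrite /binom_series; case: i => [|i].
  by rewrite leqn0 subr0; case: eqP => [->|//]; rewrite !binn.
rewrite (leq_eqVlt j) ltnS; have [->|_] /= := eqVneq j i.+1.
  by rewrite ltnn subr0 subnn !binn.
case: leqP => [leji|]; last by rewrite subr0.
by rewrite subSn // addnS binS natrD addSnnS addrC addKr.
Qed.

(** By linearity f(j+1) replaces the powers of j+1, so [f] need not be expanded in monomials. The
    coefficients that [tF_fun] drops vanish by [tF_series_eq0]. *)
Lemma coef_tF n (f : {poly_n K}) k :
  (tF K n f)`_k = mulps ((1 - 'X) ^+ (2 * n).+1)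
    (fun j => j.+1%:R * f.[j.+1%:R] * 'C(j.+1 + n, n)%:R) k.
Proof.
rewrite lfunE /= /tF_fun coefn_sum.
transitivity (\sum_(p < n) f`_p * tF_series K n p k).
  apply: eq_bigr => p _; rewrite coefZ coef_poly; congr (_ * _).
  by case: ltnP => // lenk; rewrite tF_series_eq0.
rewrite -(mulps_suml _ _ (fun p : 'I_n => f`_p)); apply: eq_mulps => j.
rewrite (horner_coef_wide _ (size_npoly f)) mulr_sumr mulr_suml.
apply: eq_bigr => p _; rewrite /tF_sum exprS !mulrA; congr (_ * _ * _).
by rewrite mulrC.
Qed.

(** * Factorial products and their binomial series *)

Lemma fact_neq0 n : n`!%:R != 0 :> K.
Proof. by rewrite pnatr_eq0 -lt0n fact_gt0. Qed.

(** The n+m+1 descending factors from i-j+n+m+1 split into three blocks: m-j factors down to i+n+2,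
    then i+n+1 down to i+1, then (i)_j. For i < j the last block is 0. *)
Lemma binom_series_falling n m j i : (j <= m)%N ->
  i.+1%:R * (n`!%:R / (n + m).+1`!%:R *
    (falling i%:R j * rising (i%:R + n.+2%:R) (m - j))) * 'C(i.+1 + n, n)%:R =
  binom_series (n + m).+1 j i :> K.
Proof.
move=> lejm; rewrite /binom_series.
case: leqP => [leji|ltij]; last first.
  by rewrite falling_nat ffact_small // mul0r !mulr0 mul0r.
apply: (mulIf (fact_neq0 (n + m).+1)).
rewrite -natrM bin_ffact -falling_nat.
have -> : (n + m).+1 = ((m - j) + (n.+1 + j))%N.
  by rewrite addnCA subnK // addSn.
rewrite !fallingD risingE !(natrD, natrB) //.
have -> : i%:R - j%:R + (m%:R - j%:R + (n.+1%:R + j%:R)) =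
   i%:R + n.+2%:R + (m%:R - j%:R) - 1 :> K by ring.
set b : K := i%:R + _ + _ - 1.
have -> : b - (m%:R - j%:R) = (i.+1 + n)%:R by rewrite /b natrD; ring.
have -> : (i.+1 + n)%:R - n.+1%:R = i%:R :> K by rewrite natrD; ring.
rewrite fallingSr [falling (i.+1 + n)%:R n]falling_nat -bin_ffact natrM natrD.
by field; exact: fact_neq0.
Qed.

(** The stated inverse image of x^p, as a product of monic linear factors so that its degree is read
    off. *)
Definition tF_inv_poly n p : {poly K} :=
  (n`!%:R / (2 * n)`!%:R) *:
  (\prod_(i < p) ('X - i.+1%:R%:P) *
   \prod_(i < n - 1 - p) ('X - (- (n + i).+1%:R)%:P)).

Lemma horner_tF_inv_poly n p y :
  (tF_inv_poly n p).[y] = n`!%:R / (2 * n)`!%:R *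
    (falling (y - 1) p * rising (y + n.+1%:R) (n - 1 - p)).
Proof.
rewrite hornerZ hornerM !horner_prod; congr (_ * (_ * _)).
  by apply: eq_bigr => i _; rewrite hornerXsubC; ring.
by apply: eq_bigr => i _; rewrite hornerXsubC -addSn natrD; ring.
Qed.

Lemma size_tF_inv_poly n p : (p < n)%N -> (size (tF_inv_poly n p) <= n)%N.
Proof.
move=> ltpn; apply: leq_trans (size_scale_leq _ _) _.
apply: leq_trans (size_polyMleq _ _) _.
rewrite !size_prod_XsubC /index_enum -!enumT !size_enum_ord.
by rewrite addnS addSn /= -subnDA add1n -addSn subnKC.
Qed.

Lemma tF_inv n (p : 'I_n) :
  tF K n (npolyp n (tF_inv_poly n p)) = tnth (npolyX K n) p.
Proof.
have n_gt0 := leq_ltn_trans (leq0n p) (ltn_ord p).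
have e2n : (2 * n = (n + (n - 1)).+1)%N.
  by rewrite -addnS subn1 prednK // addnn mul2n.
apply/val_inj/polyP => k /=; rewrite coef_tF.
rewrite npolyXE coefXn -(mulps_binom_series (2 * n) p).
apply: eq_mulps => i; rewrite npolypK ?size_tF_inv_poly // horner_tF_inv_poly.
rewrite e2n -binom_series_falling; last by rewrite subn1 -ltnS prednK.
by do !congr (_ * _); [congr falling|congr rising]; ring.
Qed.

Lemma falling_rising_expand n p (y : K) : (p < n)%N ->
  n`!%:R / (2 * n)`!%:R * (falling y p * rising (y + n.+2%:R) (n - 1 - p)) =
  \sum_(p <= m < n) 'C(n - 1 - p, n - 1 - m)%:R *
    (n`!%:R / (n + m).+1`!%:R * falling y m).
Proof.
move=> ltpn; rewrite -[X in index_iota X _]add0n big_addn.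
have er : (n - p = (n - 1 - p).+1)%N by rewrite -subnDA add1n subnSK.
rewrite er big_mkord risingE.
have e : y + n.+2%:R + (n - 1 - p)%:R - 1 = (y - p%:R) + (2 * n)%:R.
  have -> : (n - 1 - p)%:R = n%:R - 1 - p%:R :> K.
    by rewrite -subnDA natrB ?add1n // -add1n natrD; ring.
  by rewrite natrM; ring.
(* With m = p+i, (y)_p (y-p)_i = (y)_m, and the factor (2n)_(n-1-m) reduces 1/(2n)! to
   1/(n+m+1)!. *)
rewrite e falling_Vandermonde !mulr_sumr; apply: eq_bigr => i _.
have leir : (i <= n - 1 - p)%N by rewrite -ltnS.
have -> : (n - 1 - (i + p) = n - 1 - p - i)%N by rewrite addnC subnDA.
rewrite bin_sub // (addnC i) fallingD falling_nat.
have le2 : (n - 1 - p - i <= 2 * n)%N by lia.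
have := ffact_fact le2.
have -> : (2 * n - (n - 1 - p - i) = (n + (p + i)).+1)%N by lia.
move/(congr1 (fun x : nat => x%:R : K)); rewrite natrM => <-.
set F := (_.+1`!%:R); have F0 : F != 0 by exact: fact_neq0.
set G := (_ ^_ _)%:R; have G0 : G != 0.
  by rewrite pnatr_eq0 -lt0n ffact_gt0.
by field; rewrite F0 G0.
Qed.

(** [saalschutz] at s = n+2, z = i: the rising factorial of s gives the inverse binomial, and
    s+m-1-c is the upper parameter of t_m. *)
Lemma saalschutz_binom_series n m (c : K) i :
  n`!%:R / (n + m).+1`!%:R * i.+1%:R * falling (i%:R + c) m * 'C(i.+1 + n, n)%:R =
  'C(n + 1 + m, m)%:R^-1 *
  \sum_(j < m.+1)
    (gbinom (- c + (n + m + 1)%:R) j * gbinom c (m - j)) *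
      binom_series (n + m).+1 j i.
Proof.
have C0 : 'C(n + 1 + m, m)%:R != 0 :> K.
  by rewrite pnatr_eq0 -lt0n bin_gt0 leq_addl.
have rE : rising n.+2%:R m = 'C(n + 1 + m, m)%:R * m`!%:R :> K.
  rewrite risingE -natrM bin_ffact -falling_nat; congr falling.
  by rewrite !natrD; ring.
have := saalschutz c n.+2%:R i%:R m; rewrite rE => sE.
apply: (mulfI C0); rewrite mulVKf //; apply: (mulIf (fact_neq0 m)).
transitivity (n`!%:R / (n + m).+1`!%:R * i.+1%:R * 'C(i.+1 + n, n)%:R *
  (falling (i%:R + c) m * ('C(n + 1 + m, m)%:R * m`!%:R))); first by ring.
rewrite -sE mulr_sumr mulr_suml; apply: eq_bigr => j _.
have lejm : (j <= m)%N by rewrite -ltnS.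
rewrite -binom_series_falling // -(bin_fact lejm) !natrM /gbinom.
rewrite -!/(falling _ _).
have -> : n.+2%:R + m%:R - 1 - c = - c + (n + m + 1)%:R by rewrite !natrD; ring.
have Fj := fact_neq0 j; have Fm := fact_neq0 (m - j).
set d := n`!%:R / _; clearbody d.
by field; rewrite Fj Fm.
Qed.

(** * The image of x^p under [Tbeta] *)

Lemma mulps_tpoly N m (phi c : K) k :
  mulps ((1 - 'X) ^+ N.+1)
    (fun i => \sum_(j < m.+1) (gbinom phi j * gbinom c (m - j)) *
      binom_series N j i) k =
  (tpoly m phi c)`_k.
Proof.
rewrite mulps_suml coef_sum; apply: eq_bigr => j _.
by rewrite mulps_binom_series coefZ coefXn.
Qed.

Lemma Tbeta_npolyX n (beta : K) (p : 'I_n) :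
  Tbeta n beta (tnth (npolyX K n) p) =
  \sum_(p <= m < n)
     ('C(n - 1 - p, n - 1 - m)%:R / 'C(n + 1 + m, m)%:R) *:
       ((1 - 'X) ^+ (n - m - 1)
        * tpoly m (- (n%:R * beta) + (n + m + 1)%:R) (n%:R * beta))
  :> {poly K}.
Proof.
set c := n%:R * beta; apply/polyP => k.
have ltpn := ltn_ord p.
(* Writing x^p as [tF] of its explicit preimage cancels the inverse, [tF] being injective. *)
rewrite /Tbeta !comp_lfunE -tF_inv lker0_lfunK ?tF_lker0 // coef_tF -/c.
rewrite coef_sum.
transitivity (mulps ((1 - 'X) ^+ (2 * n).+1) (fun i => \sum_(p <= m < n)
   ('C(n - 1 - p, n - 1 - m)%:R / 'C(n + 1 + m, m)%:R) *
   \sum_(j < m.+1) (gbinom (- c + (n + m + 1)%:R) j * gbinom c (m - j)) *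
      binom_series (n + m).+1 j i) k).
  apply: eq_mulps => i.
  rewrite shiftE horner_comp npolypK ?size_tF_inv_poly // horner_tF_inv_poly.
  rewrite hornerD hornerX hornerC.
  have -> : i.+1%:R + c - 1 = i%:R + c by ring.
  have -> : i.+1%:R + c + n.+1%:R = (i%:R + c) + n.+2%:R by ring.
  rewrite falling_rising_expand // mulr_sumr mulr_suml; apply: eq_bigr => m _.
  rewrite -[RHS]mulrA -saalschutz_binom_series; ring.
rewrite mulps_suml big_nat [RHS]big_nat; apply: eq_bigr => m /andP[_ ltmn].
rewrite coefZ; congr (_ * _).
(* Of the 2n+1 factors 1-x, n+m+2 clear the denominator of the series and leave t_m; the other n-m-1
   remain. *)
have -> : ((2 * n).+1 = (n - m - 1) + (n + m).+2)%N by lia.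
rewrite exprD mulpsM coefM; apply: eq_bigr => j _.
by rewrite mulps_tpoly.
Qed.
End Series.

Theorem theorem21 (R : realType) (n : nat) (hn : (1 <= n)%N) (beta : R[i])
    (p : 'I_n) :
  Tbeta n beta (tnth (npolyX R[i] n) p) =
  \sum_(p <= m < n)
     ('C(n - 1 - p, n - 1 - m)%:R / 'C(n + 1 + m, m)%:R) *:
       ((1 - 'X) ^+ (n - m - 1)
        * tpoly m (- (n%:R * beta) + (n + m + 1)%:R) (n%:R * beta))
  :> {poly R[i]}.
Proof. exact: Tbeta_npolyX. Qed.
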